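(* Let $F^2$ be a smooth two-dimensional minimal surface in the three-dimensional Euclidean space $E^3$, and let $K$ be its Gaussian curvature. Then $F^2$ is $\Delta$-recurrent with eigenvalue $\varphi = 2K$; that is, the second fundamental form $b$ of $F^2$ satisfies $\Delta b = 2K\, b$ on $F^2$.
   Context: A smooth surface $F^2$ in $E^3$ is given locally by a smooth vector equation $\vec r = \vec r(u^1,u^2)$ whose Jacobian matrix $\left\|\partial x^a/\partial u^i\right\|$ has rank $2$ at every point. Let $g$ be the Riemannian metric induced on $F^2$ from $E^3$, with components $g_{ij}$ and inverse $(g^{ij})$, and let $\nabla$ be its Levi-Civita connection. Let $\vec n$ be a local smooth unit normal field (determined up to sign) and let $b = b_{ij}\,du^i du^j$, $b_{ij} = \langle \partial^2_{ij}\vec r, \vec n\rangle$, be the second fundamental form. The surface is minimal if its mean curvature $H=\tfrac12 g^{ij}b_{ij}$ vanishes identically. The Laplace operator applied to $b$ is defined by $(\Delta b)_{ij} = g^{kl}\overline\nabla_k\overline\nabla_l b_{ij}$, where $\overline\nabla$ is the van der Waerden–Bortolotti covariant derivative (the connection induced by $\nabla$ and the normal connection). Since $F^2$ has codimension one and the unit normal field is parallel in the normal bundle, this equals $(\Delta b)_{ij} = g^{kl}\nabla_k\nabla_l b_{ij}$, the rough (connection) Laplacian of the symmetric $(0,2)$-tensor $b$. The surface $F^2$ is called $\Delta$-recurrent with eigenvalue $\varphi$ if the function $\varphi$ on $F^2$ satisfies $\Delta b = \varphi b$, i.e. $(\Delta b)_{ij} = \varphi\, b_{ij}$ for $i,j=1,2$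 in local coordinates. This condition does not depend on the choice of sign of $\vec n$. *)

(* Defs.v *)
From HB Require Import structures.
From mathcomp Require Import all_boot all_order all_algebra.
From mathcomp Require Import all_classical all_reals all_analysis.

Set Implicit Arguments.
Unset Strict Implicit.
Unset Printing Implicit Defensive.

Import Order.TTheory GRing.Theory Num.Theory.
Import numFieldNormedType.Exports.

Local Open Scope classical_set_scope.
Local Open Scope ring_scope.

Definition dot (R : realType) (x y : 'rV[R]_3) : R := \sum_(a < 3) x 0 a * y 0 a.

Section LocalCoordinates.
Variable R : realType.

Definition partial (V : normedModType R) (i : 'I_2) (f : 'rV[R]_2 -> V) :
  'rV[R]_2 -> V := fun u => 'D_(delta_mx 0 i) f u.

(* C^oo on U: all iterated partial derivatives exist and are continuous.
   The functions are total, but for open U only their values on U matter. *)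
Definition smooth_on (V : normedModType R) (U : set 'rV[R]_2)
    (f : 'rV[R]_2 -> V) : Prop :=
  forall (s : seq 'I_2) (u : 'rV[R]_2), U u ->
    let h := foldr (@partial V) f s in
    {for u, continuous h} /\ forall i : 'I_2, derivable h u (delta_mx 0 i).

Definition regular_patch (U : set 'rV[R]_2) (r : 'rV[R]_2 -> 'rV[R]_3) : Prop :=
  [/\ open U, smooth_on U r &
      forall u, U u ->
        \rank (\matrix_(i < 2, a < 3) partial i r u 0 a) = 2%N].

Definition unit_normal (U : set 'rV[R]_2) (r n : 'rV[R]_2 -> 'rV[R]_3) : Prop :=
  smooth_on U n /\
  forall u, U u ->
    dot (n u) (n u) = 1 /\ forall i, dot (partial i r u) (n u) = 0.

Section FundamentalForms.
Variables r n : 'rV[R]_2 -> 'rV[R]_3.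

Definition metric (u : 'rV[R]_2) : 'M[R]_2 :=
  \matrix_(i, j) dot (partial i r u) (partial j r u).

Definition inv_metric (u : 'rV[R]_2) : 'M[R]_2 := invmx (metric u).

Definition second_form (u : 'rV[R]_2) : 'M[R]_2 :=
  \matrix_(i, j) dot (partial i (partial j r) u) (n u).

Definition mean_curv (u : 'rV[R]_2) : R :=
  2^-1 * \sum_(i < 2) \sum_(j < 2) inv_metric u i j * second_form u i j.

Definition gauss_curv (u : 'rV[R]_2) : R :=
  \det (second_form u) / \det (metric u).

(* Gamma^k_ij of the Levi-Civita connection of the metric *)
Definition christoffel (k i j : 'I_2) (u : 'rV[R]_2) : R :=
  2^-1 * \sum_(l < 2) inv_metric u k l *
    (partial i (fun v => metric v j l) u + partial j (fun v => metric v i l) u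
     - partial l (fun v => metric v i j) u).

(* Coefficient of the normal connection: the normal part of the derivative of
   n along u^k is (normal_conn k) n.  It vanishes since n has unit length. *)
Definition normal_conn (k : 'I_2) (u : 'rV[R]_2) : R := dot (partial k n u) (n u).

(* van der Waerden-Bortolotti derivative nabla_k of the normal-bundle-valued
   tensor T_ij n, as its component along n. *)
Definition nabla2 (T : 'I_2 -> 'I_2 -> 'rV[R]_2 -> R)
    (k i j : 'I_2) (u : 'rV[R]_2) : R :=
  partial k (T i j) u + normal_conn k u * T i j u
  - \sum_(m < 2) (christoffel m k i u * T m j u + christoffel m k j u * T i m u).

(* Same for a tensor T_lij n with three covariant indices. *)
Definition nabla3 (T : 'I_2 -> 'I_2 -> 'I_2 -> 'rV[R]_2 -> R)
    (k l i j : 'I_2) (u : 'rV[R]_2) : R :=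
  partial k (T l i j) u + normal_conn k u * T l i j u
  - \sum_(m < 2) (christoffel m k l u * T m i j u
                  + christoffel m k i u * T l m j u
                  + christoffel m k j u * T l i m u).

Definition laplace_b (i j : 'I_2) (u : 'rV[R]_2) : R :=
  \sum_(k < 2) \sum_(l < 2) inv_metric u k l *
    nabla3 (nabla2 (fun a b v => second_form v a b)) k l i j u.

End FundamentalForms.
End LocalCoordinates.

Section Surfaces.
Variables (R : realType) (M : topologicalType) (X : M -> 'rV[R]_3).

(* p restricted to U is a homeomorphism onto an open subset of M, and the
   position vector X, read in the coordinates p, is a regular patch. *)
Definition local_param (U : set 'rV[R]_2) (p : 'rV[R]_2 -> M) : Prop :=
  [/\ {in U &, injective p},
      forall u, U u -> {for u, continuous p},
      forall W, open W -> W `<=` U -> open (p @` W) &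
      regular_patch U (X \o p)].

(* Immersed surfaces, possibly with self-intersections.  Compatibility of the
   local parametrizations need not be imposed: a change of parameters is a
   homeomorphism between open sets intertwining two immersions into E^3, hence
   a diffeomorphism. *)
Definition smooth_surface : Prop :=
  [/\ hausdorff_space M, @second_countable M &
      forall m : M, exists U p, local_param U p /\ (p @` U) m].

Definition minimal_surface : Prop :=
  forall U p n, local_param U p -> unit_normal U (X \o p) n ->
  forall u, U u -> mean_curv (X \o p) n u = 0.

Definition is_gaussian_curvature (K : M -> R) : Prop :=
  forall U p n, local_param U p -> unit_normal U (X \o p) n ->
  forall u, U u -> K (p u) = gauss_curv (X \o p) n u.

Definition Delta_recurrent (phi : M -> R) : Prop :=
  forall U p n, local_param U p -> unit_normal U (X \o p) n ->
  forall u, U u -> forall i j : 'I_2,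
    laplace_b (X \o p) n i j u = phi (p u) * second_form (X \o p) n u i j.

End Surfaces.

(* Main.v *)
Require Import Defs.
From HB Require Import structures.
From mathcomp Require Import all_boot all_order all_algebra.
From mathcomp Require Import all_classical all_reals all_analysis.
From mathcomp Require Import ring lra.

(* The Gauss and Weingarten formulas express the derivatives of the frame
   (r_1, r_2, n).  Equating mixed third derivatives of r gives the Codazzi
   equation, so that nabla b is totally symmetric, and the Gauss equation.  With
   total symmetry,
     g^kl nabla_k nabla_l b_ij = g^kl nabla_k nabla_i b_lj,
   and commuting nabla_k with nabla_i leaves g^kl nabla_i nabla_k b_lj, which
   vanishes because b is trace-free and the metric is parallel, plus curvature
   terms.  By the Gauss equation and g^kl b_kl = 0 these reduce to -|b|^2 b_ij,
   and |b|^2 = -2K for a trace-free b in dimension two. *)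

Set Implicit Arguments.
Unset Strict Implicit.
Unset Printing Implicit Defensive.

Import Order.TTheory GRing.Theory Num.Theory.
Import numFieldNormedType.Exports.

Local Open Scope classical_set_scope.
Local Open Scope ring_scope.

(** * Symmetry of mixed derivatives *)

(** Smoothness says something only on the open set [U], so an identity is proved at every point of
    [U] before it is differentiated. The geometry is kept apart from the analysis: tensor identities
    are algebraic statements at one point, where derivatives are independent letters tied only by
    product rules and symmetries, and [ring] can close them. The awkward object is the inverse
    metric. Instead of differentiating it in a trace, the trace is multiplied by det g and written
    with the cofactors of g; parallelism of the metric then shows up as d_k (det g) = 2 Gamma^m_km
    det g. No curvature tensor is introduced. The Gauss equation replaces the antisymmetrized
    expression dGamma + Gamma Gamma directly by products of b and the shape operator, and K appears
    only at the very end, as det b times the determinant of the inverse metric. The factor 2 is that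
    of |b|^2 = (tr b)^2 - 2 K: opposite principal curvatures c and -c give |b|^2 = 2 c^2 and K = -
    c^2. *)

Section MixedDerivatives.
Variables (R : realType) (V : normedModType R).
Implicit Types (f : V -> R) (u v w x : V).

(** The difference quotients of the restriction to the line are literally those of [f] along [v], so
    directional derivability suffices and no chain rule is involved. *)
Lemma is_derive_line f x v (s : R) : derivable f (x + s *: v) v ->
  is_derive s (1 : R) (fun t : R => f (x + t *: v)) ('D_v f (x + s *: v)).
Proof.
move=> df; have E : (fun h : R => h^-1 *: (f (h *: v + (x + s *: v)) - f (x + s *: v))) =
  (fun h : R => h^-1 *: (f (x + (h *: (1 : R) + s) *: v) - f (x + s *: v))).
  apply/funext => h; congr (_ *: (f _ - _)).
  by rewrite -[h *: 1]/(h * 1) mulr1 scalerDl addrCA.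
by apply: DeriveDef; [move: df; rewrite /derivable /= E|rewrite /derive /= E].
Qed.

Lemma mean_value_line f x v (h : R) : 0 < h ->
  (forall s, 0 <= s <= h -> derivable f (x + s *: v) v) ->
  exists2 s, 0 <= s <= h & f (x + h *: v) - f x = h * 'D_v f (x + s *: v).
Proof.
move=> h0 df.
have [||c /[!in_itv]/= /andP[c0 ch]] := @MVT R (fun t => f (x + t *: v))
    (fun t => 'D_v f (x + t *: v)) 0 h h0.
- move=> c /[!in_itv]/= /andP[/ltW c0 /ltW ch].
  by apply/is_derive_line/df; rewrite c0.
- apply: derivable_within_continuous => c' /[!in_itv]/= hc.
  by case: (is_derive_line (df _ hc)).
- rewrite scale0r addr0 subr0 mulrC => E; exists c => //.
  by rewrite !ltW.
Qed.

(** Grouped as the increment along [v] of the increment along [w], yet symmetric in [v] and [w];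
    divided by [h ^+ 2] it approximates both mixed derivatives. *)
Definition second_difference f u v w (h : R) : R :=
  f (u + h *: v + h *: w) - f (u + h *: v) - (f (u + h *: w) - f u).

Lemma second_differenceC f u v w h :
  second_difference f u v w h = second_difference f u w v h.
Proof. by rewrite /second_difference -!addrA (addrC (h *: v)); ring. Qed.

(* Mean value theorem along v, then along w. *)
Lemma second_difference_near f u v w :
  (\forall x \near u, derivable f x v /\ derivable ('D_v f) x w) ->
  {for u, continuous ('D_w ('D_v f))} ->
  forall e : R, 0 < e -> exists2 d : R, 0 < d & forall h, 0 < h < d ->
    `|second_difference f u v w h - h ^+ 2 * 'D_w ('D_v f) u| <= h ^+ 2 * e.
Proof.
move=> df cf e e0.
have /nbhs_ballP[d /= d0 D] := df.
have /cvgrPdist_le /(_ _ e0) /nbhs_ballP[d' /= d'0 D'] := cf.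
(* [h * N] bounds the distance from [u] to any point of the parallelogram spanned by [h *: v] and
   [h *: w]; the summand 1 keeps [N] positive when both vectors vanish. *)
pose N := `|v| + `|w| + 1.
have N0 : 0 < N by rewrite ltr_wpDl// addr_ge0.
exists (Num.min d d' / N) => [|h /andP[h0]]; first by rewrite divr_gt0// lt_min d0.
rewrite ltr_pdivlMr// => hd.
have near_u s t : 0 <= s <= h -> 0 <= t <= h ->
    `|u - (u + s *: v + t *: w)| < Num.min d d'.
  move=> /andP[s0 sh] /andP[t0 th]; apply: le_lt_trans hd.
  rewrite -addrA opprD addNKr normrN (le_trans (ler_normD _ _))//.
  rewrite !normrZ !ger0_norm// /N !mulrDr mulr1.
  by rewrite -[leLHS]addr0 !lerD ?ler_wpM2r// ltW.
have near_dd' s t : 0 <= s <= h -> 0 <= t <= h ->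
    ball u d (u + s *: v + t *: w) /\ ball u d' (u + s *: v + t *: w).
  move=> hs ht; have := near_u s t hs ht; rewrite lt_min => /andP[].
  by rewrite -ball_normE /ball_.
have near_d s t hs ht := (near_dd' s t hs ht).1.
have hh : 0 <= h <= h by rewrite lexx ltW.
have h00 : 0 <= (0 : R) <= h by rewrite lexx ltW.
pose phi x := f (x + h *: w) - f x.
have dsh s : 0 <= s <= h -> derivable (fun x => f (x + h *: w)) (u + s *: v) v /\
   'D_v (fun x => f (x + h *: w)) (u + s *: v) = 'D_v f (u + s *: v + h *: w).
  move=> hs; have [H _] := D _ (near_d _ _ hs hh).
  have E : (fun k : R => k^-1 *:
      (f (k *: v + (u + s *: v) + h *: w) - f (u + s *: v + h *: w))) =
    (fun k : R => k^-1 *: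
      (f (k *: v + (u + s *: v + h *: w)) - f (u + s *: v + h *: w))).
    by apply/funext => k; rewrite -!addrA.
  by split; [rewrite /derivable/= E|rewrite /derive/= E].
have dphi s : 0 <= s <= h -> derivable phi (u + s *: v) v /\
   'D_v phi (u + s *: v) = 'D_v f (u + s *: v + h *: w) - 'D_v f (u + s *: v).
  move=> hs; have [H1 H2] := dsh _ hs.
  have [H3 _] := D _ (near_d _ _ hs h00); rewrite scale0r addr0 in H3.
  by split; [exact: derivableB|rewrite -H2; exact: deriveB].
have [s hs Es] := mean_value_line h0 (fun s hs => (dphi s hs).1).
have [t ht Et] := mean_value_line h0 (fun t ht => (D _ (near_d s t hs ht)).2).
have -> : second_difference f u v w h = h ^+ 2 * 'D_w ('D_v f) (u + s *: v + t *: w).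
  rewrite /second_difference -[LHS]/(phi (u + h *: v) - phi u) Es.
  by rewrite (dphi _ hs).2 Et; ring.
rewrite -mulrBr normrM ger0_norm ?sqr_ge0// ler_wpM2l ?sqr_ge0// distrC.
exact: D' (near_dd' s t hs ht).2.
Qed.

(** For one [h] small enough for both orders of differentiation, the two mixed derivatives lie
    within [e / 2] of the same quotient, hence within [e] of each other. *)
Lemma derive_comm f u v w :
  (\forall x \near u, derivable f x v /\ derivable ('D_v f) x w) ->
  (\forall x \near u, derivable f x w /\ derivable ('D_w f) x v) ->
  {for u, continuous ('D_w ('D_v f))} ->
  {for u, continuous ('D_v ('D_w f))} ->
  'D_w ('D_v f) u = 'D_v ('D_w f) u.
Proof.
move=> d1 d2 c1 c2; apply/eqP; rewrite -subr_eq0 -normr_le0.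
apply/ler_addgt0Pr => /= e e0; rewrite add0r.
have e20 : 0 < e / 2 by rewrite divr_gt0.
have [d d0 A] := second_difference_near d1 c1 e20.
have [d' d'0 B] := second_difference_near d2 c2 e20.
pose h := Num.min d d' / 2.
have h0 : 0 < h by rewrite divr_gt0// lt_min d0.
have hm : h < Num.min d d' by rewrite gtr_pMr ?invf_lt1 ?ltr1n// lt_min d0.
have A' : `|second_difference f u v w h - h ^+ 2 * 'D_w ('D_v f) u| <= h ^+ 2 * (e / 2).
  by apply: A; rewrite h0 (lt_le_trans hm)// ge_min lexx.
have B' : `|second_difference f u v w h - h ^+ 2 * 'D_v ('D_w f) u| <= h ^+ 2 * (e / 2).
  by rewrite second_differenceC; apply: B; rewrite h0 (lt_le_trans hm)// ge_min lexx orbT.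
have h20 : 0 < h ^+ 2 by rewrite exprn_gt0.
move: h20 A' B'; clear; move: (second_difference _ _ _ _ _) => S.
move: ('D_w _ u) ('D_v _ u) (h ^+ 2) => X Y k k0.
rewrite !ler_norml => /andP[A1 A2] /andP[B1 B2].
by apply/andP; split; rewrite -(ler_pM2l k0); lra.
Qed.

End MixedDerivatives.

(** * Smooth functions on an open set *)

Section SmoothFunctions.
Variables (R : realType) (U : set 'rV[R]_2).
Hypothesis oU : open U.

Lemma near_open (P : 'rV[R]_2 -> Prop) u : U u ->
  (forall x, U x -> P x) -> \forall x \near u, P x.
Proof.
by move=> Uu UP; have := open_nbhs_nbhs (conj oU Uu); apply: filterS.
Qed.

Lemma eq_on_continuous (V : normedModType R) (f g : 'rV[R]_2 -> V) u : U u ->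
  (forall x, U x -> f x = g x) -> {for u, continuous f} -> {for u, continuous g}.
Proof.
move=> Uu fg cf; rewrite /prop_for /continuous_at -(fg _ Uu).
apply: cvg_trans cf; apply: (@near_eq_cvg _ _ (nbhs u)).
exact: near_open.
Qed.

Lemma eq_on_derivable (V : normedModType R) (f g : 'rV[R]_2 -> V) u v : U u ->
  (forall x, U x -> f x = g x) -> derivable f u v -> derivable g u v.
Proof. by move=> Uu fg; apply: near_eq_derivable; exact: near_open. Qed.

Lemma eq_on_partial (V : normedModType R) (f g : 'rV[R]_2 -> V) i u : U u ->
  (forall x, U x -> f x = g x) -> partial i f u = partial i g u.
Proof. by move=> Uu fg; apply: near_eq_derive; exact: near_open. Qed.

(** A graded form of [smooth_on], made for induction on the order: the product rule expresses a
    derivative of a product through products of functions one class lower. Class 0 already asks for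
    derivability along both axes. *)
Fixpoint diff_class (V : normedModType R) k (f : 'rV[R]_2 -> V) : Prop :=
  (forall u, U u -> {for u, continuous f} /\
     forall i : 'I_2, derivable f u (delta_mx 0 i)) /\
  if k is k'.+1 then forall i, diff_class k' (partial i f) else True.

Lemma diff_class0 (V : normedModType R) k (f : 'rV[R]_2 -> V) :
  diff_class k f -> diff_class 0 f.
Proof. by case: k => [|k] []. Qed.

Lemma smooth_partial (V : normedModType R) i (f : 'rV[R]_2 -> V) :
  smooth_on U f -> smooth_on U (partial i f).
Proof. by move=> sf s u Uu; rewrite -foldr_rcons; exact: sf. Qed.

Lemma smooth_onP (V : normedModType R) (f : 'rV[R]_2 -> V) :
  smooth_on U f <-> forall k, diff_class k f.
Proof.
split=> [sf k|].
  elim: k f sf => [|k IH] f sf; split=> //; [exact: (sf [::])|exact: (sf [::])|].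
  by move=> i; apply/IH/smooth_partial.
(* [foldr] applies the last index of [s] first, whereas [diff_class] peels off the innermost
   derivative; hence the induction from the end of [s]. *)
move=> cf s; elim/last_ind: s f cf => [|s i IH] f cf.
  exact: (cf 0%N).1.
rewrite foldr_rcons; apply: IH => k; exact: (cf k.+1).2.
Qed.

(** Since [U] is open, derivatives at its points depend only on the values on [U]; formulas valid
    only there may therefore be substituted under derivatives of any order. *)
Lemma eq_on_diff_class (V : normedModType R) k (f g : 'rV[R]_2 -> V) :
  (forall x, U x -> f x = g x) -> diff_class k f -> diff_class k g.
Proof.
elim: k f g => [|k IH] f g fg [f0 fS]; split=> //.
1,2: move=> u Uu; have [cf df] := f0 u Uu; split=> [|i].
1,3: exact: (eq_on_continuous Uu fg).
1,2: exact: (eq_on_derivable Uu fg).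
by move=> i; apply: IH (fS i) => x Ux; exact: eq_on_partial.
Qed.

Lemma diff_classS (V : normedModType R) k (f : 'rV[R]_2 -> V) :
  diff_class k.+1 f -> diff_class k f.
Proof.
elim: k f => [|k IH] f [f0 fS]; split=> // i; exact: IH (fS i).
Qed.

Implicit Types f g : 'rV[R]_2 -> R.

Lemma eq_on_smooth f g : (forall x, U x -> f x = g x) ->
  smooth_on U f -> smooth_on U g.
Proof.
by move=> fg /smooth_onP sf; apply/smooth_onP => k; apply: eq_on_diff_class (sf k).
Qed.

Lemma diff_class_partialD f g i u : U u -> diff_class 0 f -> diff_class 0 g ->
  partial i (fun v => f v + g v) u = partial i f u + partial i g u.
Proof.
by move=> Uu [/(_ u Uu)[_ df] _] [/(_ u Uu)[_ dg] _]; exact: deriveD.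
Qed.

Lemma diff_class_partialM f g i u : U u -> diff_class 0 f -> diff_class 0 g ->
  partial i (fun v => f v * g v) u = partial i f u * g u + f u * partial i g u.
Proof.
move=> Uu [/(_ u Uu)[_ df] _] [/(_ u Uu)[_ dg] _].
by rewrite addrC [X in _ + X]mulrC; exact: deriveM.
Qed.

Lemma diff_class_partialV f i u : U u -> f u != 0 -> diff_class 0 f ->
  partial i (fun v => (f v)^-1) u = - ((f u)^-1 * (f u)^-1) * partial i f u.
Proof.
move=> Uu fu [/(_ u Uu)[_ df] _]; rewrite -invfM -expr2.
exact: (@deriveV _ _ f).
Qed.

Lemma diff_class_cst k (c : R) : diff_class k (fun=> c).
Proof.
elim: k c => [|k IH] c; split=> //.
1,2: by move=> u _; split=> [|i]; [exact: cst_continuous|exact: derivable_cst].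
move=> i; apply: eq_on_diff_class (IH 0) => x _.
by rewrite /partial; have := derive_cst c x (delta_mx 0 i).
Qed.

Lemma diff_classD k f g :
  diff_class k f -> diff_class k g -> diff_class k (fun v => f v + g v).
Proof.
elim: k f g => [|k IH] f g cf cg; have := diff_class0 cf; have := diff_class0 cg.
  move=> [g0 _] [f0 _]; split=> [u Uu|]; last exact: I.
  have [? ?] := f0 u Uu; have [? ?] := g0 u Uu.
  by split=> [|i]; [exact: continuousD|exact: derivableD].
move=> g0 f0; split; last first.
  move=> i; apply: eq_on_diff_class (IH _ _ (cf.2 i) (cg.2 i)) => x Ux.
  by rewrite diff_class_partialD.
exact: (diff_class0 (IH _ _ (diff_classS cf) (diff_classS cg))).1.
Qed.

Lemma diff_classM k f g :
  diff_class k f -> diff_class k g -> diff_class k (fun v => f v * g v).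
Proof.
elim: k f g => [|k IH] f g cf cg; have := diff_class0 cf; have := diff_class0 cg.
  move=> [g0 _] [f0 _]; split=> [u Uu|]; last exact: I.
  have [? ?] := f0 u Uu; have [? ?] := g0 u Uu.
  by split=> [|i]; [exact: continuousM|exact: derivableM].
move=> g0 f0; split; last first.
  move=> i; apply: eq_on_diff_class (diff_classD (IH _ _ (cf.2 i) (diff_classS cg))
    (IH _ _ (diff_classS cf) (cg.2 i))) => x Ux.
  by rewrite diff_class_partialM.
exact: (diff_class0 (IH _ _ (diff_classS cf) (diff_classS cg))).1.
Qed.

(** The derivative of 1/f is - (1/f)^2 f', which involves only 1/f itself one class lower, so the
    induction closes with [f] fixed. *)
Lemma diff_classV k f : (forall u, U u -> f u != 0) ->
  diff_class k f -> diff_class k (fun v => (f v)^-1).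
Proof.
move=> fN0; elim: k => [|k IH] cf; have f0 := diff_class0 cf.
  split=> // u Uu; have [? ?] := f0.1 u Uu.
  by split=> [|i]; [apply: continuousV|apply: derivableV] => //; exact: fN0.
have iV := IH (diff_classS cf); split; last first.
  move=> i; apply: eq_on_diff_class (diff_classM (diff_classM (diff_class_cst k (-1))
    (diff_classM iV iV)) (cf.2 i)) => x Ux.
  by rewrite diff_class_partialV ?mulN1r//; exact: fN0.
exact: (diff_class0 iV).1.
Qed.

Lemma smooth_cst (c : R) : smooth_on U (fun=> c).
Proof. by apply/smooth_onP => k; exact: diff_class_cst. Qed.

Lemma smoothD f g : smooth_on U f -> smooth_on U g ->
  smooth_on U (fun v => f v + g v).
Proof.
by move=> /smooth_onP sf /smooth_onP sg; apply/smooth_onP => k; exact: diff_classD.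
Qed.

Lemma smoothM f g : smooth_on U f -> smooth_on U g ->
  smooth_on U (fun v => f v * g v).
Proof.
by move=> /smooth_onP sf /smooth_onP sg; apply/smooth_onP => k; exact: diff_classM.
Qed.

Lemma smoothN f : smooth_on U f -> smooth_on U (fun v => - f v).
Proof.
move=> sf; apply: eq_on_smooth (smoothM (smooth_cst (-1)) sf) => x _.
exact: mulN1r.
Qed.

Lemma smoothV f : (forall u, U u -> f u != 0) -> smooth_on U f ->
  smooth_on U (fun v => (f v)^-1).
Proof.
by move=> fN0 /smooth_onP sf; apply/smooth_onP => k; exact: diff_classV.
Qed.

Lemma smooth_sum m (F : 'I_m -> 'rV[R]_2 -> R) : (forall a, smooth_on U (F a)) ->
  smooth_on U (fun v => \sum_a F a v).
Proof.
elim: m F => [|m IH] F sF.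
  by apply: eq_on_smooth (smooth_cst 0) => x _; rewrite big_ord0.
apply: eq_on_smooth (smoothD (sF ord0) (IH _ (fun a => sF (lift ord0 a)))) => x _.
by rewrite big_ord_recl.
Qed.

Lemma partial_cst (c : R) i u : partial i (fun=> c) u = 0.
Proof. exact: derive_cst. Qed.

Lemma partialD f g i u : U u -> smooth_on U f -> smooth_on U g ->
  partial i (fun v => f v + g v) u = partial i f u + partial i g u.
Proof.
by move=> Uu /smooth_onP/(_ 0%N) cf /smooth_onP/(_ 0%N) cg; exact: diff_class_partialD.
Qed.

Lemma partialM f g i u : U u -> smooth_on U f -> smooth_on U g ->
  partial i (fun v => f v * g v) u = partial i f u * g u + f u * partial i g u.
Proof.
by move=> Uu /smooth_onP/(_ 0%N) cf /smooth_onP/(_ 0%N) cg; exact: diff_class_partialM.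
Qed.

Lemma partialN f i u : U u -> smooth_on U f ->
  partial i (fun v => - f v) u = - partial i f u.
Proof. by move=> Uu /(_ [::] u Uu)[_ df]; exact: deriveN. Qed.

Lemma partial_sum m (F : 'I_m -> 'rV[R]_2 -> R) i u : U u ->
  (forall a, smooth_on U (F a)) ->
  partial i (fun v => \sum_a F a v) u = \sum_a partial i (F a) u.
Proof.
move=> Uu sF; rewrite -[RHS]/(\sum_a 'D_(delta_mx 0 i) (F a) u) -derive_sum; last first.
  by move=> a; have [_] := sF a [::] u Uu; exact.
by apply: eq_on_partial Uu _ => x _; rewrite fct_sumE.
Qed.

Lemma partialC f i j u : U u -> smooth_on U f ->
  partial i (partial j f) u = partial j (partial i f) u.
Proof.
move=> Uu sf; apply: derive_comm.
- apply: near_open Uu _ => x Ux; split; first by have [_] := sf [::] x Ux; exact.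
  by have [_] := sf [:: j] x Ux; exact.
- apply: near_open Uu _ => x Ux; split; first by have [_] := sf [::] x Ux; exact.
  by have [_] := sf [:: i] x Ux; exact.
- by have [] := sf [:: i; j] u Uu.
- by have [] := sf [:: j; i] u Uu.
Qed.

(** Reduces vector-valued maps to their coordinates, so that the rest of the calculus is scalar. *)
Lemma foldr_partial_coord m n (r : 'rV[R]_2 -> 'M[R]_(m, n)) a b s u : U u ->
  smooth_on U r ->
  foldr (@partial R R) (fun v => r v a b) s u =
  foldr (@partial R 'M[R]_(m, n)) r s u a b.
Proof.
move=> Uu sr; elim: s u Uu => [//|i s IH] u Uu /=.
have [_ /(_ i) dr] := sr s u Uu.
have /(congr1 (fun M : 'M[R]_(m, n) => M a b)) := derive_mx dr.
by rewrite mxE (eq_on_partial i Uu IH) /partial => ->.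
Qed.

Lemma smooth_coord m n (r : 'rV[R]_2 -> 'M[R]_(m, n)) a b :
  smooth_on U r -> smooth_on U (fun v => r v a b).
Proof.
move=> sr s u Uu; have [cr dr] := sr s u Uu.
have E x : U x -> foldr (@partial R _) r s x a b =
    foldr (@partial R R) (fun v => r v a b) s x.
  by move=> Ux; rewrite foldr_partial_coord.
split=> [|i].
  apply: eq_on_continuous Uu E _.
  exact: (continuous_comp cr (@coord_continuous _ m n a b _)).
by apply: eq_on_derivable Uu E _; have /derivable_mxP := dr i; exact.
Qed.

Lemma partial_coord m n (r : 'rV[R]_2 -> 'M[R]_(m, n)) a b i u : U u ->
  smooth_on U r -> partial i (fun v => r v a b) u = partial i r u a b.
Proof. by move=> Uu sr; exact: (foldr_partial_coord a b [:: i] Uu sr). Qed.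

End SmoothFunctions.

(** * Linear algebra in dimensions two and three *)

(** Fixing canonical names for the indices makes the entries coincide as atoms for [ring] and
    [field]. *)
Lemma sum2 (R : nmodType) (F : 'I_2 -> R) : \sum_i F i = F ord0 + F ord_max.
Proof.
rewrite !big_ord_recl big_ord0 addr0; congr (F _ + F _); exact: val_inj.
Qed.

Lemma sum3 (R : nmodType) (F : 'I_3 -> R) :
  \sum_i F i = F ord0 + F (lift ord0 ord0) + F ord_max.
Proof.
rewrite !big_ord_recl big_ord0 addr0 addrA; congr (F _ + F _ + F _); exact: val_inj.
Qed.

Lemma ord2_ind (P : 'I_2 -> Prop) : P ord0 -> P ord_max -> forall i, P i.
Proof.
by move=> P0 P1 [[|[|//]] Hi]; [move: P0|move: P1]; congr P; exact: val_inj.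
Qed.

Lemma det_mx22 (R : comNzRingType) (A : 'M[R]_2) :
  \det A = A ord0 ord0 * A ord_max ord_max - A ord0 ord_max * A ord_max ord0.
Proof.
rewrite (expand_det_row _ ord0) sum2 /cofactor !det_mx11 !mxE /= expr0 expr1 mul1r.
rewrite mulN1r mulrN; congr (_ * A _ _ - _ * A _ _); exact: val_inj.
Qed.

Lemma invmx22 (R : fieldType) (A : 'M[R]_2) : \det A != 0 ->
  [/\ invmx A ord0 ord0 = A ord_max ord_max / \det A,
      invmx A ord0 ord_max = - A ord0 ord_max / \det A,
      invmx A ord_max ord0 = - A ord_max ord0 / \det A &
      invmx A ord_max ord_max = A ord0 ord0 / \det A].
Proof.
move=> dA; have uA : A \in unitmx by rewrite unitmxE unitfE.
have ad : \adj A ord0 ord0 = A ord_max ord_max /\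
   \adj A ord0 ord_max = - A ord0 ord_max /\
   \adj A ord_max ord0 = - A ord_max ord0 /\ \adj A ord_max ord_max = A ord0 ord0.
  rewrite !mxE /cofactor !det_mx11 !mxE /= ?expr0 ?expr1 ?mul1r ?mulN1r.
  rewrite -signr_odd /= expr0 mul1r.
  by do !split; congr (A _ _) || congr (- A _ _); exact: val_inj.
have [a1 [a2 [a3 a4]]] := ad.
have E i j : invmx A i j = \adj A i j / \det A by rewrite /invmx uA mxE mulrC.
by rewrite !E a1 a2 a3 a4.
Qed.

(** Stacking [X] on [n] gives a square matrix [A] for which A A^T is block diagonal with blocks X
    X^T and 1; so [A] is invertible, while it sends [y^T] to 0. *)
Lemma normal_frame_complete (R : realFieldType) (X : 'M[R]_(2, 3)) (n y : 'rV[R]_3) :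
  \det (X *m X^T) != 0 -> X *m n^T = 0 -> n *m n^T = 1%:M ->
  X *m y^T = 0 -> n *m y^T = 0 -> y = 0.
Proof.
move=> dX Xn nn Xy ny; pose A : 'M[R]_(2 + 1, 3) := col_mx X n.
have AA : A *m A^T = block_mx (X *m X^T) 0 0 1%:M.
  rewrite /A tr_col_mx mul_col_row Xn nn.
  by rewrite -[n *m X^T]trmxK trmx_mul trmxK Xn trmx0.
have uA : (A : 'M[R]_3) \in unitmx.
  have : \det ((A : 'M[R]_3) *m (A : 'M[R]_3)^T) != 0.
    have -> : (A : 'M[R]_3) *m (A : 'M[R]_3)^T = block_mx (X *m X^T) 0 0 1%:M := AA.
    by rewrite (@det_ublock _ 2 1) det1 mulr1.
  by rewrite det_mulmx mulf_eq0 negb_or unitmxE unitfE => /andP[].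
have Ay : (A : 'M[R]_3) *m y^T = 0.
  by rewrite [LHS](mul_col_mx X n y^T) Xy ny col_mx0.
by rewrite -[y]trmxK -(mulKmx uA y^T) Ay mulmx0 trmx0.
Qed.

(** A vector v killed by the Gram matrix makes v X a vector whose sum of squares is 0, so v X = 0,
    against the independence of the rows. *)
Lemma det_gram_neq0 (R : realFieldType) m n (X : 'M[R]_(m, n)) :
  row_free X -> \det (X *m X^T) != 0.
Proof.
move=> fX; apply/negP => /det0P[v v0 vX].
have : (v *m X) *m (v *m X)^T = 0.
  by rewrite trmx_mul mulmxA -(mulmxA v) vX mul0mx.
have: v *m X != 0 by rewrite mulmx_free_eq0.
move: (v *m X) => w w0 /matrixP/(_ 0 0); rewrite !mxE => /eqP.
rewrite psumr_eq0 => [/allP W|i _]; last by rewrite mxE -expr2 sqr_ge0.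
move/eqP: w0; apply; apply/rowP => i; have := W i (mem_index_enum i).
by rewrite !mxE mulf_eq0 orbb => /eqP.
Qed.

(** Meant for Christoffel symbols: [c] is 1/2 and [X] the bracket of derivatives of the metric. *)
Lemma lower_index (F : comNzRingType) (h g : 'I_2 -> 'I_2 -> F) (c : F)
    (X : 'I_2 -> F) l :
  (forall i j, h i j = h j i) ->
  (forall i j, \sum_m h i m * g m j = (i == j)%:R) ->
  \sum_m c * (\sum_p h m p * X p) * g m l = c * X l :> F.
Proof.
move=> hC hg.
have -> : \sum_m c * (\sum_p h m p * X p) * g m l =
    c * \sum_p X p * \sum_m h p m * g m l :> F.
  by rewrite !sum2 (hC ord_max ord0); ring.
rewrite (bigD1 l)//= hg eqxx mulr1 big1 ?addr0// => p /negPf pl.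
by rewrite hg pl mulr0.
Qed.

Lemma sum_frame_residual (F : comNzRingType) (p z m : 'I_3 -> F) (q : 'I_2 -> 'I_3 -> F)
    (c : 'I_2 -> F) (d : F) :
  \sum_a (p a - \sum_k c k * q k a - d * m a) * z a =
  \sum_a p a * z a - \sum_k c k * (\sum_a q k a * z a) - d * \sum_a m a * z a :> F.
Proof. by rewrite !(sum2, sum3); ring. Qed.

(** Pairing with [m] isolates [d]; pairing with the [x l] then gives c g = 0, and contracting with
    [h] removes g. This splits a vector identity into its normal and tangential components. *)
Lemma frame_free (F : comNzRingType) (h g : 'I_2 -> 'I_2 -> F) (x : 'I_2 -> 'I_3 -> F)
    (m : 'I_3 -> F) (c : 'I_2 -> F) (d : F) :
  (forall i j, h i j = h j i) -> (forall i j, g i j = \sum_a x i a * x j a) ->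
  (forall i j, \sum_k h i k * g k j = (i == j)%:R) ->
  \sum_a m a * m a = 1 -> (forall i, \sum_a x i a * m a = 0) ->
  (forall a, \sum_k c k * x k a + d * m a = 0) -> d = 0 /\ forall k, c k = 0.
Proof.
move=> hC gE hg mm xm H.
have d0 : d = 0.
  have : \sum_a (\sum_k c k * x k a + d * m a) * m a =
    \sum_k c k * (\sum_a x k a * m a) + d * \sum_a m a * m a :> F.
    by rewrite !(sum2, sum3); ring.
  rewrite mm mulr1 [X in X + d]big1 ?add0r => [<-|k _]; last by rewrite xm mulr0.
  by rewrite big1// => a _; rewrite H mul0r.
split=> // k.
have cg l : \sum_k c k * g k l = 0.
  have : \sum_a (\sum_k c k * x k a + d * m a) * x l a =
    \sum_k c k * g k l + d * \sum_a x l a * m a :> F.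
    by rewrite !(sum2, sum3) !gE !sum3; ring.
  rewrite xm mulr0 addr0 => <-.
  by rewrite big1// => a _; rewrite H mul0r.
have <- : \sum_l (\sum_k c k * g k l) * h l k = c k.
  have : \sum_l (\sum_k c k * g k l) * h l k = \sum_i c i * \sum_l h k l * g l i :> F.
    rewrite !sum2 (hC k ord0) (hC k ord_max).
    have gC i j : g i j = g j i by rewrite !gE; apply: eq_bigr => a _; rewrite mulrC.
    by rewrite (gC ord_max ord0); ring.
  move=> ->; rewrite (bigD1 k)//= hg eqxx mulr1 big1 ?addr0// => p /negPf pk.
  by rewrite hg eq_sym pk mulr0.
by rewrite big1// => l _; rewrite cg mul0r.
Qed.

(** The spanning counterpart of [frame_free]: [normal_frame_complete] in index form, the Gram matrix
    being invertible because [h] is a left inverse of it. Expansions in the frame are verified by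
    applying it to the residual. *)
Lemma frame_eq0 (F : realFieldType) (h : 'I_2 -> 'I_2 -> F) (x : 'I_2 -> 'I_3 -> F)
    (n y : 'I_3 -> F) :
  (forall i j, \sum_m h i m * (\sum_a x m a * x j a) = (i == j)%:R) ->
  \sum_a n a * n a = 1 -> (forall i, \sum_a x i a * n a = 0) ->
  (forall i, \sum_a y a * x i a = 0) -> \sum_a y a * n a = 0 -> forall a, y a = 0.
Proof.
move=> hx nn xn yx yn a; pose X : 'M[F]_(2, 3) := \matrix_(i, a) x i a.
pose N : 'rV[F]_3 := \row_a n a.
suff /rowP/(_ a) : (\row_a y a : 'rV[F]_3) = 0 by rewrite !mxE.
apply: (@normal_frame_complete _ X N).
- rewrite -unitfE -unitmxE; have : (\matrix_(i, j) h i j) *m (X *m X^T) = 1%:M.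
    apply/matrixP => i j; rewrite [RHS]mxE -hx [LHS]mxE.
    apply: eq_bigr => m _; rewrite !mxE; congr (_ * _).
    by apply: eq_bigr => c _; rewrite !mxE.
  by move=> /mulmx1_unit[].
- apply/matrixP => i j; rewrite !mxE -[RHS](xn i).
  by apply: eq_bigr => c _; rewrite !mxE.
- apply/matrixP => i j; rewrite !mxE !ord1 eqxx -[RHS]nn.
  by apply: eq_bigr => c _; rewrite !mxE.
- apply/matrixP => i j; rewrite !mxE -[RHS](yx i).
  by apply: eq_bigr => c _; rewrite !mxE mulrC.
- apply/matrixP => i j; rewrite !mxE -[RHS]yn.
  by apply: eq_bigr => c _; rewrite !mxE mulrC.
Qed.

(** * Pointwise tensor identities *)

Section TensorAlgebra.
Variables (F : fieldType) (h g b w : 'I_2 -> 'I_2 -> F).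
(* [Gam m i j] stands for Gamma^m_ij; in [dGam], [db], [ddb], [dT] the first
   index, or the first two for [ddb], are those of differentiation. *)
Variables (Gam : 'I_2 -> 'I_2 -> 'I_2 -> F) (dGam : 'I_2 -> 'I_2 -> 'I_2 -> 'I_2 -> F).
Hypotheses (hC : forall i j, h i j = h j i) (bC : forall i j, b i j = b j i).
Hypothesis GamC : forall m i j, Gam m i j = Gam m j i.

(** Expanding the two equal third derivatives in the frame, the coefficients of [n] give the Codazzi
    equation and those of [x p] the Gauss equation, with [w] as shape operator. *)
Lemma compatibility (x : 'I_2 -> 'I_3 -> F) (n : 'I_3 -> F) (dn : 'I_2 -> 'I_3 -> F)
    (ddx : 'I_2 -> 'I_2 -> 'I_3 -> F) (d3x db : 'I_2 -> 'I_2 -> 'I_2 -> _) k i j :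
  (forall i j, g i j = \sum_a x i a * x j a) ->
  (forall i j, \sum_m h i m * g m j = (i == j)%:R) ->
  \sum_a n a * n a = 1 -> (forall i, \sum_a x i a * n a = 0) ->
  (forall i j a, ddx i j a = \sum_m Gam m i j * x m a + b i j * n a) ->
  (forall i a, dn i a = - \sum_m w i m * x m a) ->
  (forall k i j a, d3x k i j a =
     \sum_m (dGam k m i j * x m a + Gam m i j * ddx k m a) +
     (db k i j * n a + b i j * dn k a)) ->
  (forall a, d3x k i j a = d3x i k j a) ->
  db k i j + \sum_m Gam m i j * b k m = db i k j + \sum_m Gam m k j * b i m /\
  forall p, dGam k p i j + \sum_m Gam m i j * Gam p k m - b i j * w k p =
    dGam i p k j + \sum_m Gam m k j * Gam p i m - b k j * w i p.
Proof.
move=> gE hg nn xn gauss weingarten d3 sym.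
suff [d0 c0] : db k i j + \sum_m Gam m i j * b k m -
      (db i k j + \sum_m Gam m k j * b i m) = 0 /\
    forall p, dGam k p i j + \sum_m Gam m i j * Gam p k m - b i j * w k p -
      (dGam i p k j + \sum_m Gam m k j * Gam p i m - b k j * w i p) = 0.
  by split=> [|p]; apply/eqP; rewrite -subr_eq0 ?d0 ?c0.
apply: (@frame_free _ h g x n _ _ hC gE hg nn xn) => a.
transitivity (d3x k i j a - d3x i k j a); last by rewrite sym subrr.
by rewrite !d3 !weingarten !sum2 !gauss !sum2; ring.
Qed.

(** [T] is the covariant derivative of [b] and [S] that of [T]. In the antisymmetrization, [GamC]
    (no torsion) removes the terms correcting the index [l], the terms in [db] cancel in pairs, and
    the coefficients of [b] assemble into the curvature. *)
Lemma ricci_identity (db : 'I_2 -> 'I_2 -> 'I_2 -> F)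
    (ddb dT : 'I_2 -> 'I_2 -> 'I_2 -> 'I_2 -> F) (T : 'I_2 -> 'I_2 -> 'I_2 -> F)
    (S : 'I_2 -> 'I_2 -> 'I_2 -> 'I_2 -> F) k l i j :
  (forall l i j, T l i j = db l i j -
     \sum_m (Gam m l i * b m j + Gam m l j * b i m)) ->
  (forall k l i j, dT k l i j = ddb k l i j -
     \sum_m ((dGam k m l i * b m j + Gam m l i * db k m j) +
             (dGam k m l j * b i m + Gam m l j * db k i m))) ->
  (forall k l i j, S k l i j = dT k l i j -
     \sum_m (Gam m k l * T m i j + Gam m k i * T l m j + Gam m k j * T l i m)) ->
  ddb k l i j = ddb l k i j ->
  S k l i j - S l k i j = - \sum_p (
    (dGam k p l i + \sum_m Gam m l i * Gam p k m
      - (dGam l p k i + \sum_m Gam m k i * Gam p l m)) * b p j +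
    (dGam k p l j + \sum_m Gam m l j * Gam p k m
      - (dGam l p k j + \sum_m Gam m k j * Gam p l m)) * b i p) :> F.
Proof.
move=> TE dTE SE dd.
by rewrite !SE !dTE dd !sum2 (GamC ord0 l k) (GamC ord_max l k) !TE !sum2; ring.
Qed.

(** The numerator is polynomial in [g] and [t], so a vanishing trace can be differentiated without
    touching [h]. *)
Lemma trace_cofactor (D : F) (t : 'I_2 -> 'I_2 -> F) : D != 0 ->
  h ord0 ord0 = g ord_max ord_max / D -> h ord0 ord_max = - g ord0 ord_max / D ->
  h ord_max ord0 = - g ord0 ord_max / D -> h ord_max ord_max = g ord0 ord0 / D ->
  \sum_i \sum_j h i j * t i j =
  (g ord_max ord_max * t ord0 ord0 - g ord0 ord_max * (t ord0 ord_max + t ord_max ord0) +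
    g ord0 ord0 * t ord_max ord_max) / D :> F.
Proof. by move=> D0 h1 h2 h3 h4; rewrite !sum2 h1 h2 h3 h4; field. Qed.

(** The cofactor expression is det g times the trace, and det g has logarithmic derivative 2
    Gamma^m_km when the metric is parallel. Replacing the partial by the covariant derivative thus
    costs only a multiple of the expression itself, which is zero. *)
Lemma trace_nabla (dT : 'I_2 -> 'I_2 -> 'I_2 -> F) (T : 'I_2 -> 'I_2 -> F)
    (dg : 'I_2 -> 'I_2 -> 'I_2 -> F) k :
  (forall i j, g i j = g j i) ->
  (forall i j, dg k i j = \sum_m (Gam m k i * g m j + Gam m k j * g m i)) ->
  g ord_max ord_max * T ord0 ord0 - g ord0 ord_max * (T ord0 ord_max + T ord_max ord0) +
    g ord0 ord0 * T ord_max ord_max = 0 ->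
  (dg k ord_max ord_max * T ord0 ord0 + g ord_max ord_max * dT k ord0 ord0) -
   (dg k ord0 ord_max * (T ord0 ord_max + T ord_max ord0) +
    g ord0 ord_max * (dT k ord0 ord_max + dT k ord_max ord0)) +
   (dg k ord0 ord0 * T ord_max ord_max + g ord0 ord0 * dT k ord_max ord_max) = 0 ->
  forall D : 'I_2 -> 'I_2 -> F, (forall i j, D i j = dT k i j -
    \sum_m (Gam m k i * T m j + Gam m k j * T i m)) ->
  g ord_max ord_max * D ord0 ord0 - g ord0 ord_max * (D ord0 ord_max + D ord_max ord0) +
    g ord0 ord0 * D ord_max ord_max = 0.
Proof.
move=> gC dgE tr0 dtr0 D DE.
set t := (X in X = 0) in tr0; set dt := (X in X = 0) in dtr0.
have -> : g ord_max ord_max * D ord0 ord0 -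
    g ord0 ord_max * (D ord0 ord_max + D ord_max ord0) +
    g ord0 ord0 * D ord_max ord_max = dt - (\sum_m Gam m k m) * t *+ 2 :> F.
  by rewrite /dt /t !DE !dgE !sum2 (gC ord_max ord0); ring.
by rewrite tr0 dtr0 mulr0 mul0rn subr0.
Qed.

(* The terms b w w cancel, the terms containing the trace of b vanish, and what
   is left is -|b|^2 b, where |b|^2 = (tr b)^2 - 2 det b / det g. *)
Lemma simons_algebra (S : 'I_2 -> 'I_2 -> 'I_2 -> 'I_2 -> F)
    (Q : 'I_2 -> 'I_2 -> 'I_2 -> 'I_2 -> F) i j :
  (forall i p, w i p = \sum_q b i q * h q p) ->
  \sum_k \sum_l h k l * b k l = 0 ->
  (forall m k l j, S m k l j = S m l k j) -> (forall m k l j, S m k l j = S m k j l) ->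
  (forall m j, \sum_k \sum_l h k l * S m k l j = 0) ->
  (forall k l i p, Q k l i p = b l i * w k p - b k i * w l p) ->
  (forall k l i j, S k l i j - S l k i j =
     - \sum_p (Q k l i p * b p j + Q k l j p * b i p)) ->
  \sum_k \sum_l h k l * S k l i j =
  (2 * (b ord0 ord0 * b ord_max ord_max - b ord0 ord_max * b ord_max ord0) *
   (h ord0 ord0 * h ord_max ord_max - h ord0 ord_max * h ord_max ord0)) * b i j :> F.
Proof.
move=> wE tr0 S12 S23 trS QE ricci.
transitivity (\sum_k \sum_l h k l * (S i k l j -
    \sum_p (Q k i l p * b p j + Q k i j p * b l p))).
  apply: eq_bigr => k _; apply: eq_bigr => l _; congr (_ * _).
  by rewrite S12 -ricci addrC subrK.
have -> : \sum_k \sum_l h k l * (S i k l j -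
    \sum_p (Q k i l p * b p j + Q k i j p * b l p)) =
  \sum_k \sum_l h k l * S i k l j -
  \sum_k \sum_l h k l * (\sum_p (Q k i l p * b p j + Q k i j p * b l p)) :> F.
  by rewrite !sum2; ring.
rewrite trS sub0r; apply/eqP; rewrite -subr_eq0; apply/eqP.
set t := (X in X = 0) in tr0.
(* The first term in the parenthesis comes from the part of [Q] containing [b k l], the second from
   the square of the trace in |b|^2. *)
transitivity (t * (\sum_p w i p * b p j - t * b i j)); last by rewrite tr0 mul0r.
rewrite /t; move: i j {trS}.
by elim/ord2_ind; elim/ord2_ind; rewrite !sum2 !QE !wE !sum2
  (hC ord_max ord0) (bC ord_max ord0); ring.
Qed.

End TensorAlgebra.

(** * Minimal surfaces in coordinates *)

(* The rules for partial derivatives are axiomatized so that no unification in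
   the tensor calculus below ever unfolds a limit. *)
Record partial_calculus (R : realFieldType) (T : Type) (U : T -> Prop)
  (P : 'I_2 -> (T -> R) -> T -> R) (sm : (T -> R) -> Prop) : Prop :=
    PartialCalculus {
  pc_ext : forall i f f' u, U u -> (forall v, U v -> f v = f' v) -> P i f u = P i f' u;
  pc_cst : forall i c u, P i (fun=> c) u = 0;
  pc_add : forall f f' i u, U u -> sm f -> sm f' ->
    P i (fun v => f v + f' v) u = P i f u + P i f' u;
  pc_opp : forall f i u, U u -> sm f -> P i (fun v => - f v) u = - P i f u;
  pc_mul : forall f f' i u, U u -> sm f -> sm f' ->
    P i (fun v => f v * f' v) u = P i f u * f' u + f u * P i f' u;
  pc_sum : forall m (F : 'I_m -> T -> R) i u, U u -> (forall a, sm (F a)) ->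
    P i (fun v => \sum_a F a v) u = \sum_a P i (F a) u;
  pc_comm : forall f i j u, U u -> sm f -> P i (P j f) u = P j (P i f) u;
  pc_smooth : forall i f, sm f -> sm (P i f);
  pc_smooth_add : forall f f', sm f -> sm f' -> sm (fun v => f v + f' v);
  pc_smooth_opp : forall f, sm f -> sm (fun v => - f v);
  pc_smooth_mul : forall f f', sm f -> sm f' -> sm (fun v => f v * f' v);
  pc_smooth_sum : forall m (F : 'I_m -> T -> R), (forall a, sm (F a)) ->
    sm (fun v => \sum_a F a v) }.

Section MinimalSurfaceEquations.
Variables (R : realFieldType) (T : Type) (U : T -> Prop).
Variables (P : 'I_2 -> (T -> R) -> T -> R) (sm : (T -> R) -> Prop).
Hypothesis pc : partial_calculus U P sm.
Let P_ext := pc_ext pc.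
Let P_cst := pc_cst pc.
Let PD := pc_add pc.
Let PN := pc_opp pc.
Let PM := pc_mul pc.
Let P_sum := pc_sum pc.
Let PC := pc_comm pc.
Let smP := pc_smooth pc.
Let smD := pc_smooth_add pc.
Let smN := pc_smooth_opp pc.
Let smM := pc_smooth_mul pc.
Let sm_sum := pc_smooth_sum pc.

Variables (r n : 'I_3 -> T -> R) (g h b : 'I_2 -> 'I_2 -> T -> R) (D : T -> R).
Variable Gam : 'I_2 -> 'I_2 -> 'I_2 -> T -> R.
Hypotheses (r_sm : forall a, sm (r a)) (n_sm : forall a, sm (n a)).
Hypotheses (g_sm : forall i j, sm (g i j)) (b_sm : forall i j, sm (b i j)).
Hypothesis Gam_sm : forall k i j, sm (Gam k i j).
Hypothesis gE : forall i j u, U u -> g i j u = \sum_a P i (r a) u * P j (r a) u.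
Hypothesis bE : forall i j u, U u -> b i j u = \sum_a P i (P j (r a)) u * n a u.
Hypothesis nn : forall u, U u -> \sum_a n a u * n a u = 1.
Hypothesis rn : forall i u, U u -> \sum_a P i (r a) u * n a u = 0.
Hypothesis hgK : forall i j u, U u -> \sum_m h i m u * g m j u = (i == j)%:R.
Hypothesis D_neq0 : forall u, U u -> D u != 0.
Hypothesis hE : forall u, U u ->
  [/\ h ord0 ord0 u = g ord_max ord_max u / D u,
      h ord0 ord_max u = - g ord0 ord_max u / D u,
      h ord_max ord0 u = - g ord0 ord_max u / D u &
      h ord_max ord_max u = g ord0 ord0 u / D u].
Hypothesis GamE : forall k i j u, U u -> Gam k i j u =
  2^-1 * \sum_l h k l u * (P i (g j l) u + P j (g i l) u - P l (g i j) u).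

Lemma P_dot (F G : 'I_3 -> T -> R) i u : U u ->
  (forall a, sm (F a)) -> (forall a, sm (G a)) ->
  P i (fun v => \sum_a F a v * G a v) u =
  \sum_a P i (F a) u * G a u + \sum_a P i (G a) u * F a u.
Proof.
move=> Uu sF sG; rewrite (P_sum i Uu (fun a => smM (sF a) (sG a))).
rewrite -big_split; apply: eq_bigr => a _; rewrite PM//=.
by rewrite [X in _ + X]mulrC.
Qed.

Lemma gC i j u : U u -> g i j u = g j i u.
Proof. by move=> Uu; rewrite !gE//; apply: eq_bigr => a _; rewrite mulrC. Qed.

Lemma hC i j u : U u -> h i j u = h j i u.
Proof.
move=> Uu; have [_ E1 E2 _] := hE Uu; move: i j.
by elim/ord2_ind; elim/ord2_ind => //; rewrite E1 E2.
Qed.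

Lemma bC i j u : U u -> b i j u = b j i u.
Proof. by move=> Uu; rewrite !bE//; apply: eq_bigr => a _; rewrite PC. Qed.

Lemma GamC k i j u : U u -> Gam k i j u = Gam k j i u.
Proof.
move=> Uu; rewrite !GamE//; congr (_ * _); apply: eq_bigr => l _; congr (_ * _).
rewrite [X in X - _]addrC; congr (_ - _); apply: P_ext => // v; exact: gC.
Qed.

Lemma Gam_lower i j l u : U u -> \sum_m Gam m i j u * g m l u =
  2^-1 * (P i (g j l) u + P j (g i l) u - P l (g i j) u).
Proof.
move=> Uu; rewrite -(@lower_index _ (fun i j => h i j u) (fun i j => g i j u) 2^-1
   (fun l => P i (g j l) u + P j (g i l) u - P l (g i j) u) l).
- by apply: eq_bigr => m _; rewrite GamE.
- by move=> p q; exact: hC.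
- by move=> p q; exact: hgK.
Qed.

Lemma P_metric k i j u : U u ->
  P k (g i j) u = \sum_m (Gam m k i u * g m j u + Gam m k j u * g m i u).
Proof.
move=> Uu; rewrite big_split /= !Gam_lower//.
have -> : P k (g j i) u = P k (g i j) u by apply: P_ext => // v; exact: gC.
by field.
Qed.

(** Koszul's argument: a derivative of the metric is a sum of two such products, these are symmetric
    in their first two indices, and four of the six terms on the right cancel. *)
Lemma second_dot_tangent i j l u : U u -> \sum_a P i (P j (r a)) u * P l (r a) u =
  2^-1 * (P i (g j l) u + P j (g i l) u - P l (g i j) u).
Proof.
move=> Uu; pose s i j l := \sum_a P i (P j (r a)) u * P l (r a) u.
have dg p q t : P p (g q t) u = s p q t + s p t q.
  have sP q' : forall a, sm (P q' (r a)) by move=> a; exact: smP.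
  rewrite -(P_dot p Uu (sP q) (sP t)); apply: P_ext => // v Uv.
  exact: gE.
have sC p q t : s p q t = s q p t by apply: eq_bigr => a _; rewrite PC.
by rewrite !dg -[LHS]/(s i j l) (sC j i l) (sC l i j) (sC l j i); field.
Qed.

(** Identifies the Christoffel symbols, defined from the metric alone, with the tangential
    coefficients of the second derivatives of [r]: the residual is orthogonal to the whole frame. *)
Lemma gauss_formula i j a u : U u ->
  P i (P j (r a)) u = \sum_m Gam m i j u * P m (r a) u + b i j u * n a u.
Proof.
move=> Uu; apply/eqP; rewrite -subr_eq0 opprD addrA; apply/eqP.
apply: (@frame_eq0 _ (fun i j => h i j u) (fun i a => P i (r a) u) (n^~ u)
  (fun a => P i (P j (r a)) u - \sum_m Gam m i j u * P m (r a) u - b i j u * n a u)).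
- by move=> p q; rewrite -(hgK p q Uu); apply: eq_bigr => m _; rewrite gE.
- exact: nn.
- by move=> p; exact: rn.
- move=> l; rewrite (sum_frame_residual _ _ (n^~ u) (fun k a => P k (r a) u)).
  have -> : \sum_a n a u * P l (r a) u = 0.
    by rewrite -[RHS](rn l Uu); apply: eq_bigr => c _; rewrite mulrC.
  rewrite mulr0 subr0 second_dot_tangent// -Gam_lower//.
  apply/eqP; rewrite subr_eq0; apply/eqP; apply: eq_bigr => m _.
  by rewrite gE.
- rewrite (sum_frame_residual _ _ (n^~ u) (fun k a => P k (r a) u)).
  rewrite nn// mulr1 -bE// big1 ?subr0 ?subrr// => m _.
  by rewrite rn// mulr0.
Qed.

Lemma normal_derivative i u : U u -> \sum_a P i (n a) u * n a u = 0.
Proof.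
move=> Uu; have : P i (fun v => \sum_a n a v * n a v) u = 0.
  by rewrite -[RHS](P_cst i 1 u); apply: P_ext => // v; exact: nn.
rewrite (P_dot i Uu n_sm n_sm) => /eqP.
by rewrite -mulr2n mulrn_eq0 /= => /eqP.
Qed.

(** The shape operator b_i^p, with its second index raised. *)
Definition shape (i p : 'I_2) u := \sum_q b i q u * h q p u.

Lemma weingarten_formula i a u : U u ->
  P i (n a) u = - \sum_m shape i m u * P m (r a) u.
Proof.
move=> Uu; apply/eqP; rewrite -subr_eq0 opprK; apply/eqP.
have nr l : \sum_a P i (n a) u * P l (r a) u = - b i l u.
  have : P i (fun v => \sum_a P l (r a) v * n a v) u = 0.
    by rewrite -[RHS](P_cst i 0 u); apply: P_ext => // v; exact: rn.
  rewrite (P_dot i Uu (fun a => smP l (r_sm a)) n_sm) -bE// => /eqP.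
  by rewrite addrC addr_eq0 => /eqP.
(* The normal coefficient 0 gives the residual the form treated by [sum_frame_residual]. *)
suff : P i (n a) u - \sum_m (- shape i m u) * P m (r a) u - 0 * n a u = 0.
  by rewrite mul0r subr0 !sum2 => <-; ring.
apply: (@frame_eq0 _ (fun i j => h i j u) (fun i a => P i (r a) u) (n^~ u)
  (fun a => P i (n a) u - \sum_m (- shape i m u) * P m (r a) u - 0 * n a u)).
- by move=> p q; rewrite -(hgK p q Uu); apply: eq_bigr => m _; rewrite gE.
- exact: nn.
- by move=> p; exact: rn.
- move=> l; rewrite (sum_frame_residual _ _ (n^~ u) (fun k a => P k (r a) u)).
  rewrite mul0r subr0 nr.
  have -> : \sum_m - shape i m u * (\sum_a P m (r a) u * P l (r a) u) =
     - \sum_q b i q u * \sum_m h q m u * g m l u :> R.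
    by rewrite /shape !sum2 !gE//; ring.
  rewrite opprK (bigD1 l)//= hgK// eqxx mulr1 big1 ?addr0 ?addNr// => q.
  by move=> /negPf ql; rewrite hgK// ql mulr0.
- rewrite (sum_frame_residual _ _ (n^~ u) (fun k a => P k (r a) u)).
  rewrite mul0r subr0 normal_derivative// big1 ?subr0// => m _.
  by rewrite rn// mulr0.
Qed.

Lemma codazzi_gauss k i j u : U u ->
  P k (b i j) u + \sum_m Gam m i j u * b k m u =
  P i (b k j) u + \sum_m Gam m k j u * b i m u /\
  forall p, P k (Gam p i j) u + \sum_m Gam m i j u * Gam p k m u - b i j u * shape k p u =
    P i (Gam p k j) u + \sum_m Gam m k j u * Gam p i m u - b k j u * shape i p u.
Proof.
move=> Uu; apply: (@compatibility _ (fun i j => h i j u) (fun i j => g i j u)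
  (fun i j => b i j u) (fun i j => shape i j u) (fun m i j => Gam m i j u)
  (fun k m i j => P k (Gam m i j) u) (fun i j => hC i j Uu)
  (fun i a => P i (r a) u) (n^~ u) (fun i a => P i (n a) u)
  (fun i j a => P i (P j (r a)) u) (fun k i j a => P k (P i (P j (r a))) u)
  (fun k i j => P k (b i j) u) k i j).
- by move=> p q; exact: gE.
- by move=> p q; exact: hgK.
- exact: nn.
- by move=> p; exact: rn.
- by move=> p q a; exact: gauss_formula.
- by move=> p a; exact: weingarten_formula.
- move=> t p q a.
  have sPr m : sm (P m (r a)) by exact: smP.
  have -> : P t (P p (P q (r a))) u =
      P t (fun v => \sum_m Gam m p q v * P m (r a) v + b p q v * n a v) u.
    by apply: P_ext => // v; exact: gauss_formula.
  rewrite PD//; [|by apply: sm_sum => m; exact: smM|exact: smM].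
  rewrite (PM t Uu (b_sm p q) (n_sm a)) P_sum//; last by move=> m; exact: smM.
  by congr (_ + _); apply: eq_bigr => m _; rewrite PM.
- by move=> a; apply: PC => //; exact: smP.
Qed.

(** [nabla2] applied to b with the normal connection coefficient put to zero; [normal_conn0] later
    justifies this. *)
Definition nabla_b l i j u :=
  P l (b i j) u - \sum_m (Gam m l i u * b m j u + Gam m l j u * b i m u).

Definition nabla2_b k l i j u := P k (nabla_b l i j) u -
  \sum_m (Gam m k l u * nabla_b m i j u + Gam m k i u * nabla_b l m j u +
          Gam m k j u * nabla_b l i m u).

Lemma P_cov (B : 'I_2 -> 'I_2 -> T -> R) k l i j u : U u -> (forall i j, sm (B i j)) ->
  P k (fun v => P l (B i j) v -
    \sum_m (Gam m l i v * B m j v + Gam m l j v * B i m v)) u =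
  P k (P l (B i j)) u -
    \sum_m ((P k (Gam m l i) u * B m j u + Gam m l i u * P k (B m j) u) +
            (P k (Gam m l j) u * B i m u + Gam m l j u * P k (B i m) u)).
Proof.
move=> Uu sB.
have s1 m p q t : sm (fun v => Gam m l p v * B q t v) by exact: smM.
have s2 : forall m, sm (fun v => Gam m l i v * B m j v + Gam m l j v * B i m v).
  by move=> m; exact: smD.
rewrite PD//; [|exact: smP|by apply: smN; exact: sm_sum].
rewrite PN//; last exact: sm_sum.
rewrite P_sum//; congr (_ - _); apply: eq_bigr => m _.
by rewrite PD// !PM.
Qed.

Lemma nabla_b_sm l i j : sm (nabla_b l i j).
Proof.
apply: smD; first exact: smP.
by apply: smN; apply: sm_sum => m; apply: smD; exact: smM.
Qed.

(** One connection term is symmetric in [l] and [i] because Gamma is; exchanging these indices in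
    the remaining terms is the Codazzi equation. *)
Lemma nabla_b_sym12 l i j u : U u -> nabla_b l i j u = nabla_b i l j u.
Proof.
move=> Uu; have [E _] := codazzi_gauss l i j Uu.
apply/eqP; rewrite -subr_eq0; apply/eqP.
transitivity (P l (b i j) u + \sum_m Gam m i j u * b l m u -
  (P i (b l j) u + \sum_m Gam m l j u * b i m u)); last by rewrite E subrr.
rewrite /nabla_b !sum2 (GamC ord0 l i Uu) (GamC ord_max l i Uu); ring.
Qed.

Lemma nabla_b_sym23 l i j u : U u -> nabla_b l i j u = nabla_b l j i u.
Proof.
move=> Uu; rewrite /nabla_b; congr (_ - _).
  by apply: P_ext => // v; exact: bC.
by apply: eq_bigr => m _; rewrite addrC (bC m j)// (bC i m).
Qed.

Lemma nabla2_b_sym23 k l i j u : U u -> nabla2_b k l i j u = nabla2_b k i l j u.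
Proof.
move=> Uu; rewrite /nabla2_b; congr (_ - _).
  by apply: P_ext => // v; exact: nabla_b_sym12.
apply: eq_bigr => m _.
rewrite (nabla_b_sym12 m i j Uu) (nabla_b_sym12 l m j Uu) (nabla_b_sym12 l i m Uu).
by ring.
Qed.

Lemma nabla2_b_sym34 k l i j u : U u -> nabla2_b k l i j u = nabla2_b k l j i u.
Proof.
move=> Uu; rewrite /nabla2_b; congr (_ - _).
  by apply: P_ext => // v; exact: nabla_b_sym23.
apply: eq_bigr => m _.
rewrite (nabla_b_sym23 m i j Uu) (nabla_b_sym23 l m j Uu) (nabla_b_sym23 l i m Uu).
by ring.
Qed.

Lemma ricci_b k l i j u : U u -> nabla2_b k l i j u - nabla2_b l k i j u =
  - \sum_p ((b l i u * shape k p u - b k i u * shape l p u) * b p j u +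
            (b l j u * shape k p u - b k j u * shape l p u) * b i p u).
Proof.
move=> Uu; rewrite (@ricci_identity _ (fun i j => b i j u)
  (fun m i j => Gam m i j u) (fun k m i j => P k (Gam m i j) u)
  (fun m i j => GamC m i j Uu) (fun k i j => P k (b i j) u)
  (fun k l i j => P k (P l (b i j)) u) (fun k l i j => P k (nabla_b l i j) u)
  (fun l i j => nabla_b l i j u) (fun k l i j => nabla2_b k l i j u) k l i j) //.
- congr (- _); apply: eq_bigr => p _.
  have [_ /(_ p) E1] := codazzi_gauss k l i Uu.
  have [_ /(_ p) E2] := codazzi_gauss k l j Uu.
  (* Regroups the Gauss equation so that the curvature expression of [ricci_identity] stands alone
     on one side. *)
  have aux (x y z t : R) : x - y = z - t -> x - z = y - t.
    by move=> H; rewrite -[x](subrK y) H; ring.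
  by rewrite (aux _ _ _ _ E1) (aux _ _ _ _ E2).
- by move=> k' l' i' j'; exact: P_cov.
- exact: PC.
Qed.

(** The trace vanishes on all of [U], hence so does its cofactor form, which can be differentiated;
    [trace_nabla] turns the outcome into the trace of the covariant derivative. *)
Lemma trace_parallel (t : 'I_2 -> 'I_2 -> T -> R) k u : U u -> (forall i j, sm (t i j)) ->
  (forall v, U v -> \sum_i \sum_j h i j v * t i j v = 0) ->
  \sum_i \sum_j h i j u * (P k (t i j) u -
    \sum_m (Gam m k i u * t m j u + Gam m k j u * t i m u)) = 0.
Proof.
move=> Uu st trt.
have cof v : U v -> g ord_max ord_max v * t ord0 ord0 v +
   - (g ord0 ord_max v * (t ord0 ord_max v + t ord_max ord0 v)) +
    g ord0 ord0 v * t ord_max ord_max v = 0.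
  move=> Uv; have [h1 h2 h3 h4] := hE Uv; have := trt v Uv.
  rewrite (@trace_cofactor _ (fun i j => h i j v) (fun i j => g i j v) (D v)
    (fun i j => t i j v) (D_neq0 Uv) h1 h2 h3 h4) => /eqP.
  by rewrite mulf_eq0 invr_eq0 (negPf (D_neq0 Uv)) orbF => /eqP.
have dcof : P k (fun v => g ord_max ord_max v * t ord0 ord0 v +
   - (g ord0 ord_max v * (t ord0 ord_max v + t ord_max ord0 v)) +
    g ord0 ord0 v * t ord_max ord_max v) u = 0.
  by rewrite -[RHS](P_cst k 0 u); apply: P_ext.
have s1 i j p q : sm (fun v => g i j v * t p q v) by exact: smM.
have s2 : sm (fun v => t ord0 ord_max v + t ord_max ord0 v) by exact: smD.
have s3 : sm (fun v => g ord0 ord_max v * (t ord0 ord_max v + t ord_max ord0 v)).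
  exact: smM.
rewrite PD// in dcof; last by apply: smD => //; exact: smN.
rewrite PD// in dcof; last exact: smN.
rewrite PN// !PM// PD// in dcof.
have [h1 h2 h3 h4] := hE Uu.
rewrite (@trace_cofactor _ (fun i j => h i j u) (fun i j => g i j u) (D u)
    (fun i j => P k (t i j) u - \sum_m (Gam m k i u * t m j u + Gam m k j u * t i m u))
   (D_neq0 Uu) h1 h2 h3 h4).
rewrite [X in X / _](_ : _ = 0) ?mul0r//.
apply: (@trace_nabla _ (fun i j => g i j u) (fun m i j => Gam m i j u)
  (fun k i j => P k (t i j) u) (fun i j => t i j u) (fun k i j => P k (g i j) u) k
  (fun i j => gC i j Uu) (fun i j => P_metric k i j Uu) (cof u Uu) dcof
  (fun i j => P k (t i j) u - \sum_m (Gam m k i u * t m j u + Gam m k j u * t i m u))).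
by [].
Qed.

Hypothesis minimal : forall u, U u -> \sum_i \sum_j h i j u * b i j u = 0.

Lemma trace_nabla_b m u : U u -> \sum_k \sum_l h k l u * nabla_b m k l u = 0.
Proof. by move=> Uu; exact: trace_parallel. Qed.

Lemma trace_nabla2_b m j u : U u -> \sum_k \sum_l h k l u * nabla2_b m k l j u = 0.
Proof.
move=> Uu.
have trT p v : U v -> \sum_k \sum_l h k l v * nabla_b k l p v = 0.
  move=> Uv; rewrite -[RHS](trace_nabla_b p Uv); apply: eq_bigr => k _.
  by apply: eq_bigr => l _; rewrite (nabla_b_sym23 k l p Uv) (nabla_b_sym12 k p l Uv).
(* Here [j] is a mere label of the two-tensor; the connection term belonging to it is added
   afterwards and is a combination of traces that vanish by [trT]. *)
have A := trace_parallel m Uu (fun k l => nabla_b_sm k l j) (trT j).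
have -> : \sum_k \sum_l h k l u * nabla2_b m k l j u =
  \sum_k \sum_l h k l u * (P m (nabla_b k l j) u -
    \sum_p (Gam p m k u * nabla_b p l j u + Gam p m l u * nabla_b k p j u)) -
  \sum_p Gam p m j u * (\sum_k \sum_l h k l u * nabla_b k l p u) :> R.
  by rewrite /nabla2_b !sum2; ring.
by rewrite A sub0r big1 ?oppr0// => p _; rewrite trT// mulr0.
Qed.

(** The product of the two determinants is K, as the determinant of [h] is the inverse of that of
    [g]. *)
Lemma laplacian_second_form i j u : U u ->
  \sum_k \sum_l h k l u * nabla2_b k l i j u =
  2 * ((b ord0 ord0 u * b ord_max ord_max u - b ord0 ord_max u * b ord_max ord0 u) *
   (h ord0 ord0 u * h ord_max ord_max u - h ord0 ord_max u * h ord_max ord0 u)) * b i j u.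
Proof.
move=> Uu; rewrite mulrA.
apply: (@simons_algebra _ (fun i j => h i j u) (fun i j => b i j u)
  (fun i j => shape i j u) (fun i j => hC i j Uu) (fun i j => bC i j Uu)
  (fun k l i j => nabla2_b k l i j u)
  (fun k l i p => b l i u * shape k p u - b k i u * shape l p u) i j).
- by [].
- exact: minimal.
- by move=> m k l q; exact: nabla2_b_sym23.
- by move=> m k l q; exact: nabla2_b_sym34.
- by move=> m q; exact: trace_nabla2_b.
- by [].
- by move=> k l p q; exact: ricci_b.
Qed.

End MinimalSurfaceEquations.

(** * Regular patches as a model of the abstract calculus *)

Section Surface.
Variables (R : realType) (U : set 'rV[R]_2) (r n : 'rV[R]_2 -> 'rV[R]_3).
Hypotheses (rp : regular_patch U r) (un : unit_normal U r n).

Local Notation x i a := (partial i (fun v => r v 0 a)).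
Local Notation xx i j a := (partial i (partial j (fun v => r v 0 a))).
Local Notation nu a := (fun v => n v 0 a).
Local Notation g i j := (fun v => metric r v i j).
Local Notation h i j := (fun v => inv_metric r v i j).
Local Notation b i j := (fun v => second_form r n v i j).
Local Notation Gam := (christoffel r).

Lemma patch_open : open U. Proof. by case: rp. Qed.
Local Notation oU := patch_open.

Lemma patch_smooth a : smooth_on U (fun v => r v 0 a).
Proof. by case: rp => ? sr _; exact: (smooth_coord _ 0 a sr). Qed.
Local Notation sr := patch_smooth.

Lemma tangent_smooth i a : smooth_on U (x i a).
Proof. by apply: smooth_partial; exact: sr. Qed.
Local Notation sx := tangent_smooth.

Lemma normal_smooth a : smooth_on U (nu a).
Proof. by case: un => sn _; exact: (smooth_coord oU 0 a sn). Qed.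
Local Notation sn := normal_smooth.

Lemma tangentE i u a : U u -> partial i r u 0 a = x i a u.
Proof. by move=> Uu; rewrite (partial_coord oU)//; case: rp. Qed.

Lemma metric_dot u i j : metric r u i j = dot (partial i r u) (partial j r u).
Proof. exact: mxE. Qed.

Lemma metricE u i j : U u -> metric r u i j = \sum_a x i a u * x j a u.
Proof.
move=> Uu; rewrite metric_dot; apply: eq_bigr => a _.
by congr (_ * _); exact: tangentE.
Qed.

Lemma second_formE u i j : U u -> second_form r n u i j = \sum_a xx i j a u * n u 0 a.
Proof.
move=> Uu; transitivity (dot (partial i (partial j r) u) (n u)); first exact: mxE.
apply: eq_bigr => a _; congr (_ * _).
by rewrite -[LHS](foldr_partial_coord oU 0 a [:: i; j])//; case: rp.
Qed.

Lemma normal_unit u : U u -> \sum_a n u 0 a * n u 0 a = 1.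
Proof. by case: un => _ H /H[]. Qed.

Lemma normal_orth u i : U u -> \sum_a x i a u * n u 0 a = 0.
Proof.
move=> Uu; have [_ /(_ u Uu)[_ /(_ i) E]] := un.
by rewrite -[RHS]E /dot; apply: eq_bigr => a _; rewrite tangentE.
Qed.

Lemma metricC u i j : metric r u i j = metric r u j i.
Proof. by rewrite !metric_dot; apply: eq_bigr => a _; exact: mulrC. Qed.

Lemma metric_jac u : metric r u = (\matrix_(i < 2, a < 3) partial i r u 0 a) *m
  (\matrix_(i < 2, a < 3) partial i r u 0 a)^T.
Proof.
apply/matrixP => i j; rewrite metric_dot [RHS]mxE; apply: eq_bigr => a _.
by congr (_ * _); rewrite ?[(_^T) _ _]mxE mxE.
Qed.

(** The metric is the Gram matrix of the Jacobian, whose rows are independent by the rank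
    condition. *)
Lemma det_metric_neq0 u : U u -> \det (metric r u) != 0.
Proof.
move=> Uu; rewrite metric_jac; apply: det_gram_neq0.
by case: rp => _ _ /(_ u Uu) /eqP.
Qed.

Lemma inv_metricE u : U u ->
  [/\ inv_metric r u ord0 ord0 = metric r u ord_max ord_max / \det (metric r u),
      inv_metric r u ord0 ord_max = - metric r u ord0 ord_max / \det (metric r u),
      inv_metric r u ord_max ord0 = - metric r u ord0 ord_max / \det (metric r u) &
      inv_metric r u ord_max ord_max = metric r u ord0 ord0 / \det (metric r u)].
Proof.
move=> Uu; have [-> -> -> ->] := invmx22 (det_metric_neq0 Uu).
by rewrite (metricC u ord_max ord0).
Qed.

Lemma inv_metricK u i j : U u ->
  \sum_m inv_metric r u i m * metric r u m j = (i == j)%:R.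
Proof.
move=> Uu; have : metric r u \in unitmx by rewrite unitmxE unitfE det_metric_neq0.
by move=> /mulVmx/matrixP/(_ i j); rewrite !mxE => <-.
Qed.

Lemma metric_smooth i j : smooth_on U (g i j).
Proof.
apply: (eq_on_smooth oU (fun v Uv => esym (metricE i j Uv))).
exact: (smooth_sum oU (fun a => smoothM oU (sx i a) (sx j a))).
Qed.

Lemma second_form_smooth i j : smooth_on U (b i j).
Proof.
apply: (eq_on_smooth oU (fun v Uv => esym (second_formE i j Uv))).
exact: (smooth_sum oU (fun a => smoothM oU (smooth_partial i (sx j a)) (sn a))).
Qed.

Lemma inv_metric_smooth i j : smooth_on U (h i j).
Proof.
have sg := metric_smooth.
have sD : smooth_on U (fun v => (\det (metric r v))^-1).
  apply: (smoothV oU det_metric_neq0).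
  apply: (eq_on_smooth oU (fun v _ => esym (det_mx22 (metric r v)))).
  exact: (smoothD oU (smoothM oU (sg _ _) (sg _ _))
                     (smoothN oU (smoothM oU (sg _ _) (sg _ _)))).
have sgD k l := smoothM oU (sg k l) sD.
have sgND k l := smoothM oU (smoothN oU (sg k l)) sD.
move: i j; elim/ord2_ind; elim/ord2_ind.
- by apply: (eq_on_smooth oU _ (sgD ord_max ord_max)) => v /inv_metricE[].
- by apply: (eq_on_smooth oU _ (sgND ord0 ord_max)) => v /inv_metricE[].
- by apply: (eq_on_smooth oU _ (sgND ord0 ord_max)) => v /inv_metricE[].
- by apply: (eq_on_smooth oU _ (sgD ord0 ord0)) => v /inv_metricE[].
Qed.

Lemma christoffel_smooth k i j : smooth_on U (Gam k i j).
Proof.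
have sdg p q l : smooth_on U (partial p (g q l)) := smooth_partial p (metric_smooth q l).
exact: (smoothM oU (smooth_cst oU _) (smooth_sum oU (fun l =>
  smoothM oU (inv_metric_smooth k l)
    (smoothD oU (smoothD oU (sdg i j l) (sdg j i l)) (smoothN oU (sdg l i j)))))).
Qed.

Lemma partial_calculus_smooth_on : partial_calculus U (@partial R R) (smooth_on U).
Proof.
split.
- by move=> i f f' u; exact: (eq_on_partial oU).
- by move=> i c u; exact: partial_cst.
- by move=> f f' i u; exact: partialD.
- by move=> f i u; exact: partialN.
- by move=> f f' i u; exact: partialM.
- by move=> m F i u; exact: (partial_sum oU).
- by move=> f i j u; exact: (partialC oU).
- by move=> i f; exact: smooth_partial.
- exact: (smoothD oU).
- exact: (smoothN oU).
- exact: (smoothM oU).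
- exact: (smooth_sum oU).
Qed.
Local Notation pc := partial_calculus_smooth_on.

Lemma normal_conn0 u k : U u -> normal_conn n k u = 0.
Proof.
move=> Uu; transitivity (\sum_a partial k (nu a) u * n u 0 a).
  apply: eq_bigr => a _; apply: (congr2 *%R) => //; apply/esym/(partial_coord oU) => //.
  by case: un.
exact: (normal_derivative pc sn normal_unit k Uu).
Qed.

Lemma laplace_b_minimal u i j :
  (forall v, U v -> mean_curv r n v = 0) -> U u ->
  laplace_b r n i j u = 2 * gauss_curv r n u * second_form r n u i j.
Proof.
move=> H0 Uu.
have nabla2E v k l m : U v ->
    nabla2 r n (fun a b v => second_form r n v a b) k l m v =
    nabla_b (@partial R R) (fun i j => b i j) Gam k l m v.
  by move=> Uv; rewrite /nabla2 /nabla_b (normal_conn0 k Uv) mul0r addr0.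
have nabla3E k l :
    nabla3 r n (nabla2 r n (fun a b v => second_form r n v a b)) k l i j u =
    nabla2_b (@partial R R) (fun i j => b i j) Gam k l i j u.
  rewrite /nabla3 /nabla2_b (normal_conn0 k Uu) mul0r addr0; apply: (congr2 +%R).
    by apply: (eq_on_partial oU) => // v; exact: nabla2E.
  apply: (congr1 -%R); apply: eq_bigr => m _.
  by rewrite (nabla2E u m i j Uu) (nabla2E u l m j Uu) (nabla2E u l i m Uu).
transitivity (\sum_k \sum_l h k l u *
    nabla2_b (@partial R R) (fun i j => b i j) Gam k l i j u).
  by apply: eq_bigr => k _; apply: eq_bigr => l _; rewrite nabla3E.
rewrite (laplacian_second_form (r := fun a v => r v 0 a) (n := fun a => nu a)
  (g := fun i j => g i j) (h := fun i j => h i j) (b := fun i j => b i j)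
  (D := fun v => \det (metric r v)) pc sr sn metric_smooth second_form_smooth
  christoffel_smooth (fun i j v => @metricE v i j)
  (fun i j v => @second_formE v i j) normal_unit (fun i v => @normal_orth v i)
  (fun i j v => @inv_metricK v i j) det_metric_neq0 inv_metricE
  (* The hypothesis left open is the vanishing of the trace of b: [mean_curv] is zero and its factor
     1/2 is not. *)
  (fun k i j v _ => erefl) _ i j Uu); last first.
  move=> v /H0 /eqP; rewrite /mean_curv mulf_eq0 invr_eq0 pnatr_eq0 /= => /eqP.
  exact.
rewrite /gauss_curv !det_mx22; congr (_ * _ * _); congr (_ * _).
(* With the cofactor entries, the determinant of the inverse metric is det g / (det g)^2, which is
   the denominator of [gauss_curv]. *)
have [-> -> -> ->] := inv_metricE Uu.
have := det_metric_neq0 Uu; rewrite det_mx22 (metricC u ord_max ord0).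
by move: (metric r u _ _) (metric r u _ _) (metric r u _ _) => x y z d; field.
Qed.

End Surface.

Theorem theorem0p2 (R : realType) (M : topologicalType) (X : M -> 'rV[R]_3)
    (K : M -> R) :
  smooth_surface X -> minimal_surface X -> is_gaussian_curvature X K ->
  Delta_recurrent X (fun m => 2 * K m).
Proof.
move=> _ minX KX U p n Up pn u Uu i j; have [_ _ _ rp] := Up.
rewrite (laplace_b_minimal rp pn i j (minX U p n Up pn) Uu).
by rewrite (KX U p n Up pn u Uu).
Qed.
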